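(* Consider the planted dense bipartite subgraph detection problem $\mathsf{PDBS}(n,k_{R},k_{L},p,q)$ described in the context, with optimal risk $\mathsf{R}_n^\star$. For $x,y\in\mathbb{N}$ let $\gamma_n(x,y)=\log\left(1+\frac{n}{xy}\cdot\frac{\log 2}{2}\right)$. Suppose that $$\chi^2(p\|q)\le \frac{n\,\gamma_n(k_R,k_L)}{8k_Rk_L},$$ and that at least one of the following two conditions holds: $$\text{(i)}\quad \chi^2(p\|q)\le \max\left\{\frac{\gamma_n(k_R,k_R)}{2k_L},\ \frac{\gamma_n(k_L,k_L)}{2k_R}\right\};$$ $$\text{(ii)}\quad \chi^2(p\|q)\le \max\left\{\min\left\{\frac{1}{2k_L},\ \frac{n\,\gamma_n(k_L,k_L)}{8k_R^2}\right\},\ \min\left\{\frac{1}{2k_R},\ \frac{n\,\gamma_n(k_R,k_R)}{8k_L^2}\right\}\right\}.$$ Then strong detection is impossible, with $\mathsf{R}_n^\star>1/2$.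
   Context: Detection problem $\mathsf{PDBS}(n,k_R,k_L,p,q)$: the observation is a simple undirected graph $G$ on vertex set $[n]=\{1,\dots,n\}$. Under the null hypothesis $\mathcal{H}_0$, $G\sim\mathcal{G}(n,q)$ (Erdős–Rényi: each of the $\binom n2$ possible edges present independently with probability $q$). Under the alternative $\mathcal{H}_1$: a set $\mathcal{R}\subset[n]$ of size $k_R$ is chosen uniformly at random, then a set $\mathcal{L}\subseteq[n]\setminus\mathcal{R}$ of size $k_L$ is chosen uniformly at random; each pair $\{i,j\}$ with one endpoint in $\mathcal{R}$ and the other in $\mathcal{L}$ (the $k_Rk_L$ ''planted'' edges) is present independently with probability $p$, and every other pair is present independently with probability $q$. Standing assumptions: $0<q<p$, $q<1$, and the asymptotic regime $n\to\infty$ with $k_R+k_L=o(n)$ (parameters $k_R,k_L,p,q$ may depend on $n$). For a test $\phi:\{0,1\}^{\binom n2}\to\{0,1\}$, its risk is $\mathsf{R}_n(\phi)=\mathbb{P}_{\mathcal{H}_0}(\phi(G)=1)+\mathbb{P}_{\mathcal{H}_1}(\phi(G)=0)$, and $\mathsf{R}_n^\star=\inf_\phi \mathsf{R}_n(\phi)$ (infimum over all, possibly randomized, tests). Strong detection means $\lim_{n\to\infty}\mathsf{R}_n(\phi_n)=0$ for some sequence of tests. $\chi^2(p\|q)=\frac{(p-q)^2}{q(1-q)}$ denotes the $\chi^2$-divergence between $\mathrm{Bern}(p)$ and $\mathrm{Bern}(q)$. *)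

(* Defs.v *)
From mathcomp Require Import all_boot all_order all_algebra.
From mathcomp Require Import all_classical all_reals all_analysis.

Set Implicit Arguments.
Unset Strict Implicit.
Unset Printing Implicit Defensive.

Import Order.TTheory GRing.Theory Num.Theory.
Import numFieldNormedType.Exports.

Local Open Scope ring_scope.

(* The vertex set [n] = {1, ..., n} is represented by 'I_n = {0, ..., n-1}. *)
Definition edge (n : nat) := {e : {set 'I_n} | #|e| == 2%N}.

(* A simple undirected graph, as an element of {0,1}^(n choose 2). *)
Definition graph (n : nat) := {ffun edge n -> bool}.

Definition crossing n (A B : {set 'I_n}) (e : edge n) : bool :=
  [exists i in A, exists j in B, val e == [set i; j]%SET].

Section Model.
Context {R : realType}.

Definition uniform_average (T : finType) (A : {set T}) (f : T -> R) : R :=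
  (\sum_(x in A) f x) / #|A|%:R.

(* Probability mass function of the random graph whose edges e are present
   independently with probabilities r e. *)
Definition independent_edges n (r : edge n -> R) (G : graph n) : R :=
  \prod_(e : edge n) (if G e then r e else 1 - r e).

Definition null_law n (q : R) : graph n -> R :=
  independent_edges (fun=> q).

Definition planted_law n (p q : R) (A B : {set 'I_n}) : graph n -> R :=
  independent_edges (fun e => if crossing A B e then p else q).

(* Meaningful for kR + kL <= n; otherwise one of the two averages is over an
   empty set and the value is 0. *)
Definition alternative_law n (kR kL : nat) (p q : R) (G : graph n) : R :=
  uniform_average [set A : {set 'I_n} | #|A| == kR]%SET (fun A =>
    uniform_average [set B : {set 'I_n} | (B \subset ~: A) && (#|B| == kL)]%SET
      (fun B => planted_law p q A B G)).

(* A possibly randomized test outputs 1 on the observation G with probability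
   phi G; deterministic tests are those with values in {0, 1}. *)
Definition is_test n (phi : graph n -> R) : Prop :=
  forall G, 0 <= phi G <= 1.

Definition risk n (kR kL : nat) (p q : R) (phi : graph n -> R) : R :=
  \sum_(G : graph n) null_law q G * phi G +
  \sum_(G : graph n) alternative_law kR kL p q G * (1 - phi G).

Definition optimal_risk (n kR kL : nat) (p q : R) : R :=
  inf [set risk kR kL p q phi | phi in @is_test n]%classic.

Definition strong_detection (kR kL : nat -> nat) (p q : nat -> R) : Prop :=
  exists phi : forall n, graph n -> R,
    (forall n, is_test (phi n)) /\
    ((fun n => risk (kR n) (kL n) (p n) (q n) (phi n)) @ \oo --> (0 : R))%classic.

Definition chi2 (p q : R) : R := (p - q) ^+ 2 / (q * (1 - q)).

Definition gamma (n x y : nat) : R :=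
  ln (1 + n%:R / (x%:R * y%:R) * (ln 2 / 2)).

End Model.

(* Main.v *)
(** Second moment method. By AM-GM every test has risk at least
    [1 - E_0 [L ^ 2] / 4], where L is the likelihood ratio. For independent
    copies (A, B), (A', B') of the planted sets, [E_0 [L ^ 2]] is the mean of
    [(1 + chi2) ^ N], where N counts the pairs crossing both and
    [N <= |A :&: A'| |B :&: B'| + |A :&: B'| |B :&: A'|]. AM-GM separates the
    exponentials of the two products. In each of them one intersection is
    either bounded by a cardinality (condition (i)) or averaged out
    conditionally on the other (condition (ii)); what remains is the moment
    generating function of a hypergeometric variable at gamma, which is at most
    [exp (ln 2 / 2) <= 3 / 2]. So the risk is at least 5/8. *)

Require Import Defs.
From mathcomp Require Import all_boot all_order all_algebra.
From mathcomp Require Import all_classical all_reals all_analysis.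
(* [finset] again, since [classical_sets] shadows many of its names. *)
From mathcomp Require Import finset.
From mathcomp Require Import zify ring lra.

Set Implicit Arguments.
Unset Strict Implicit.
Unset Printing Implicit Defensive.

Import Order.TTheory GRing.Theory Num.Theory.
Import numFieldNormedType.Exports.
Local Open Scope ring_scope.

(** * Averages over finite sets *)

Section UniformAverage.
Variables (R : realType) (T : finType).
Implicit Types (A : {set T}) (f g : T -> R).

Lemma eq_uniform_average A f g :
  {in A, f =1 g} -> uniform_average A f = uniform_average A g.
Proof. by move=> fg; rewrite /uniform_average (eq_bigr _ fg). Qed.

Lemma ler_uniform_average A f g :
  {in A, forall x, f x <= g x} -> uniform_average A f <= uniform_average A g.
Proof. by move=> fg; rewrite ler_wpM2r ?invr_ge0//; exact: ler_sum. Qed.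

Lemma uniform_average_cst A (c : R) :
  (0 < #|A|)%N -> uniform_average A (fun=> c) = c.
Proof.
move=> A0; rewrite /uniform_average sumr_const -(mulr_natr c) mulfK//.
by rewrite pnatr_eq0 -lt0n.
Qed.

Lemma uniform_average_le A f (c : R) :
  (0 < #|A|)%N -> {in A, forall x, f x <= c} -> uniform_average A f <= c.
Proof.
by move=> A0 fc; rewrite -(uniform_average_cst c A0); exact: ler_uniform_average.
Qed.

Lemma uniform_averageZl A (c : R) f :
  uniform_average A (fun x => c * f x) = c * uniform_average A f.
Proof. by rewrite /uniform_average -mulr_sumr mulrA. Qed.

Lemma uniform_averageD A f g :
  uniform_average A (fun x => f x + g x) =
  uniform_average A f + uniform_average A g.
Proof. by rewrite /uniform_average big_split mulrDl. Qed.

Lemma uniform_average_sum (I : finType) (P : {pred I}) A (F : I -> T -> R) :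
  uniform_average A (fun x => \sum_(i in P) F i x) =
  \sum_(i in P) uniform_average A (F i).
Proof. by rewrite /uniform_average exchange_big mulr_suml. Qed.

End UniformAverage.

(** * Uniform k-subsets, hypergeometric moments and two-stage draws *)

Definition ksubsets (T : finType) (U : {set T}) (k : nat) : {set {set T}} :=
  [set X : {set T} | (X \subset U) && (#|X| == k)].

Lemma card_ksubsets (T : finType) (U : {set T}) k :
  #|ksubsets U k| = 'C(#|U|, k).
Proof. exact: cards_draws. Qed.

(** Removing [Y] is a bijection onto the subsets of [U :\: Y] of size [k - #|Y|], with inverse
    [Z |-> Y :|: Z]. *)
Lemma card_ksubsets_sup (T : finType) (U Y : {set T}) k :
  Y \subset U -> (#|Y| <= k)%N ->
  #|[set X in ksubsets U k | Y \subset X]| = 'C(#|U| - #|Y|, k - #|Y|).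
Proof.
move=> YU Yk.
have -> : [set X in ksubsets U k | Y \subset X] =
    [set Y :|: Z | Z in ksubsets (U :\: Y) (k - #|Y|)].
  apply/setP => X; rewrite !inE; apply/idP/imsetP.
    move=> /andP[/andP[XU /eqP Xk] YX]; exists (X :\: Y).
      by rewrite inE setSD//= cardsD (setIidPr YX) Xk.
    by rewrite setDE setUIr setUCr setIT; apply/esym/setUidPr.
  move=> [Z]; rewrite inE => /andP[ZU /eqP Zk] ->.
  have /andP[ZU' ZY] : (Z \subset U) && [disjoint Z & Y] by rewrite -subsetD.
  rewrite subUset YU ZU' subsetUl andbT/= cardsU.
  by rewrite setIC (disjoint_setI0 ZY) cards0 subn0 Zk subnKC.
rewrite card_in_imset; first by rewrite card_ksubsets cardsD (setIidPr YU).
move=> Z1 Z2; rewrite !inE => /andP[+ _] /andP[+ _].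
rewrite !subsetD => /andP[_ d1] /andP[_ d2] e.
have := congr1 (fun X => X :\: Y) e; rewrite !setDUl !setDv !set0U.
by rewrite (setDidPl d1) (setDidPl d2).
Qed.

(** The ratio of the binomials is the product of [(k - i) / (u - i)] over [i < t], and each factor
    is at most [k / u]. Cross-multiplying keeps the induction in [nat]. *)
Lemma leq_bin_sub u k t : (t <= k)%N -> (k <= u)%N ->
  ('C(u - t, k - t) * u ^ t <= 'C(u, k) * k ^ t)%N.
Proof.
move=> + ku; elim: t => [|t IH] tk; first by rewrite !subn0.
have {}IH := IH (ltnW tk).
have ut : (0 < u - t)%N by rewrite subn_gt0 (leq_trans tk).
rewrite -(leq_pmul2l ut).
have -> : ((u - t) * ('C(u - t.+1, k - t.+1) * u ^ t.+1) =
           ((k - t) * u) * ('C(u - t, k - t) * u ^ t))%N.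
  have e : ((u - t) * 'C(u - t.+1, k - t.+1) = (k - t) * 'C(u - t, k - t))%N.
    by rewrite !subnS -{1}(prednK ut) mul_bin_diag !prednK// subn_gt0.
  by rewrite mulnA e expnS; lia.
have -> : ((u - t) * ('C(u, k) * k ^ t.+1) =
           ((u - t) * k) * ('C(u, k) * k ^ t))%N by rewrite expnS; lia.
by apply: leq_mul IH; rewrite !mulnBl leq_sub// ?leq_mul2l ?ku ?orbT// mulnC.
Qed.

Lemma superset_prob_le (R : realType) (T : finType) (U Y : {set T}) k :
  (k <= #|U|)%N -> (0 < #|U|)%N ->
  uniform_average (ksubsets U k) (fun X => (Y \subset X)%:R) <=
  (k%:R / #|U|%:R) ^+ #|Y| :> R.
Proof.
move=> kU U0; rewrite /uniform_average card_ksubsets -natr_sum.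
have -> : (\sum_(X in ksubsets U k) (Y \subset X))%N =
          #|[set X in ksubsets U k | Y \subset X]|.
  rewrite -sum1_card big_mkcond [RHS]big_mkcond/=; apply: eq_bigr => X _.
  by rewrite !inE; case: (_ && _); case: (_ \subset _).
have u0 : 0 < #|U|%:R :> R by rewrite ltr0n.
rewrite ler_pdivrMr ?ltr0n ?bin_gt0// expr_div_n mulrAC.
rewrite ler_pdivlMr ?exprn_gt0// -!natrX -!natrM ler_nat.
(* Unless [Y \subset U] and [#|Y| <= k], no [X] contains [Y] and the left side vanishes. *)
have [YU|nYU] := boolP (Y \subset U); last first.
  rewrite (_ : [set _ in _ | _] = set0) ?cards0//.
  apply/setP => X; rewrite !inE; apply/negP => /andP[/andP[XU _] YX].
  by rewrite (fintype.subset_trans YX XU) in nYU.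
have [Yk|kY] := leqP #|Y| k; last first.
  rewrite (_ : [set _ in _ | _] = set0) ?cards0//.
  apply/setP => X; rewrite !inE; apply/negP => /andP[/andP[_ /eqP Xk] YX].
  by have := subset_leq_card YX; rewrite Xk leqNgt kY.
by rewrite card_ksubsets_sup// [leqRHS]mulnC leq_bin_sub.
Qed.

(* Expand [z ^ #|S :&: X| = \prod_(i in S :&: X) (1 + (z - 1))] over the
   subsets Y of S; the expected value of [Y \subset X] is at most
   [(k / #|U|) ^ #|Y|]. *)
Lemma hypergeometric_mgf_le (R : realType) (T : finType) (U S : {set T}) k
    (z : R) : (k <= #|U|)%N -> (0 < #|U|)%N -> 1 <= z ->
  uniform_average (ksubsets U k) (fun X => z ^+ #|S :&: X|) <=
  expR (#|S|%:R * (k%:R / #|U|%:R * (z - 1))).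
Proof.
move=> kU U0 z1.
have expand (W : {set T}) (c : R) :
    (1 + c) ^+ #|W| = \sum_(Y in powerset W) c ^+ #|Y|.
  rewrite -prodr_const big_mkcond/=.
  rewrite (eq_bigr (fun i => (if i \in W then c else 0) + 1)); last first.
    by move=> i _; case: ifP; rewrite ?add0r// addrC.
  rewrite bigA_distr/= [RHS]big_mkcond/=; apply: eq_bigr => Y _.
  rewrite -big_mkcond/= powersetE; case: (boolP (Y \subset W)) => YW.
    rewrite -prodr_const; apply: eq_bigr => i iY.
    by rewrite (fintype.subsetP YW).
  have [i iY iW] := subsetPn YW.
  by rewrite (bigD1 i)//= (negPf iW) mul0r.
have -> : uniform_average (ksubsets U k) (fun X => z ^+ #|S :&: X|) =
    \sum_(Y in powerset S) (z - 1) ^+ #|Y| *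
      uniform_average (ksubsets U k) (fun X => (Y \subset X)%:R).
  under [RHS]eq_bigr do rewrite -uniform_averageZl.
  rewrite -uniform_average_sum; apply: eq_uniform_average => X _.
  rewrite -{1}(subrKC 1 z) expand big_mkcond [RHS]big_mkcond/=.
  apply: eq_bigr => Y _; rewrite !powersetE subsetI.
  by case: (Y \subset S) => //=; case: (Y \subset X); rewrite ?mulr1 ?mulr0.
apply: (@le_trans _ _ (\sum_(Y in powerset S)
    (k%:R / #|U|%:R * (z - 1)) ^+ #|Y|)).
  apply: ler_sum => Y _; rewrite exprMn mulrC.
  by rewrite ler_wpM2r ?exprn_ge0 ?subr_ge0// superset_prob_le.
rewrite -expand expRM_natl lerXn2r ?nnegrE ?expR_ge0//.
  by rewrite addr_ge0// mulr_ge0 ?subr_ge0// divr_ge0.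
exact: expR_ge1Dx.
Qed.

(* The value of gamma is calibrated so that the bound of
   [hypergeometric_mgf_le] is [exp (ln 2 / 2)]. *)
Lemma hypergeometric_mgf_gamma (R : realType) n (S : {set 'I_n}) k :
  (0 < #|S|)%N -> (0 < k <= n)%N ->
  uniform_average (ksubsets [set: 'I_n] k)
    (fun X => expR (gamma n #|S| k * #|S :&: X|%:R)) <= 3 / 2 :> R.
Proof.
move=> S0 /andP[k0 kn].
have n0 : (0 < n)%N := leq_trans k0 kn.
have ln2 : 0 <= ln 2 / 2 :> R by rewrite divr_ge0// ln_ge0 // ler1n.
have c0 : 0 <= n%:R / (#|S|%:R * k%:R) * (ln 2 / 2) :> R.
  by rewrite mulr_ge0// divr_ge0// mulr_ge0.
under eq_uniform_average => X _ do rewrite expRM_natr /gamma lnK ?posrE ?ltr_pwDl//.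
apply: le_trans (hypergeometric_mgf_le _ _ _ _) _.
- by rewrite cardsT card_ord.
- by rewrite cardsT card_ord.
- by rewrite lerDl.
rewrite cardsT card_ord addrC addKr.
have -> : #|S|%:R * (k%:R / n%:R * (n%:R / (#|S|%:R * k%:R) * (ln 2 / 2))) =
    ln 2 / 2 :> R.
  by field; rewrite !pnatr_eq0 -!lt0n n0 S0 k0.
(* The bound is the square root of 2; after squaring, the claim is [2 <= 9 / 4]. *)
rewrite -(@ler_pXn2r _ 2) ?nnegrE ?expR_ge0// -expRM_natr divfK ?lnK ?posrE//.
lra.
Qed.

(** Fibres of constant size make the two-stage draw uniform on the set of pairs. *)
Lemma uniform_average_dep (R : realType) (T1 T2 : finType) (A : {set T1})
    (B : T1 -> {set T2}) (c : nat) (f : T1 -> T2 -> R) :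
  {in A, forall x, #|B x| = c} ->
  uniform_average A (fun x => uniform_average (B x) (f x)) =
  uniform_average [set x | (x.1 \in A) && (x.2 \in B x.1)]
    (fun x => f x.1 x.2).
Proof.
move=> Bc; rewrite /uniform_average.
have pairs_sum (U : nmodType) (g : T1 -> T2 -> U) :
    \sum_(x in [set x | (x.1 \in A) && (x.2 \in B x.1)]) g x.1 x.2 =
    \sum_(x in A) \sum_(y in B x) g x y.
  by rewrite pair_big_dep/=; apply: eq_bigl => x; rewrite inE.
rewrite pairs_sum -[in RHS]sum1_card.
rewrite (pairs_sum nat (fun _ _ => 1%N)).
rewrite (eq_bigr (fun x => (\sum_(y in B x) f x y) / c%:R)); last first.
  by move=> x xA; rewrite Bc.
rewrite -mulr_suml (eq_bigr (fun=> c)); last by move=> x xA; rewrite sum1_card Bc.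
by rewrite sum_nat_const natrM invfM mulrAC mulrA.
Qed.

(** * Planted pairs and their exchange symmetry *)

Section Model.
Context {R : realType} {n : nat}.
Implicit Types (p q : R) (A B : {set 'I_n}) (G : graph n) (a b : nat).

(** Joint form of the draw of the planted sets: the symmetry between them, hidden by drawing one
    after the other, becomes a bijection. *)
Definition disjoint_pairs a b : {set {set 'I_n} * {set 'I_n}} :=
  [set x | (x.1 \in ksubsets [set: 'I_n] a) && (x.2 \in ksubsets (~: x.1) b)].

Lemma uniform_average_disjoint_pairs a b (f : {set 'I_n} -> {set 'I_n} -> R) :
  uniform_average (disjoint_pairs a b) (fun x => f x.1 x.2) =
  uniform_average (ksubsets [set: 'I_n] a) (fun A =>
    uniform_average (ksubsets (~: A) b) (f A)).
Proof.
rewrite (@uniform_average_dep _ _ _ _ _ ('C(n - a, b)))// => A.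
rewrite inE => /andP[_ /eqP Aa].
by rewrite card_ksubsets cardsCs setCK Aa card_ord.
Qed.

Lemma swap_disjoint_pairs a b :
  disjoint_pairs b a = [set (x.2, x.1) | x in disjoint_pairs a b].
Proof.
apply/setP => -[B A]; rewrite !inE/=; apply/idP/imsetP.
  move=> /andP[/andP[_ Bb] /andP[AB Aa]]; exists (A, B) => //.
  by rewrite !inE/= finset.subsetT Aa Bb -disjoints_subset disjoint_sym
    disjoints_subset AB.
move=> [[A' B']]; rewrite !inE/= => /andP[/andP[_ Bb] /andP[AB Aa]] [-> ->].
by rewrite finset.subsetT Aa Bb -disjoints_subset disjoint_sym
  disjoints_subset AB.
Qed.

Lemma uniform_average_swap a b (f : {set 'I_n} * {set 'I_n} -> R) :
  uniform_average (disjoint_pairs b a) f =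
  uniform_average (disjoint_pairs a b) (fun x => f (x.2, x.1)).
Proof.
have inj : injective (fun x : {set 'I_n} * {set 'I_n} => (x.2, x.1)).
  by move=> [? ?] [? ?] [-> ->].
by rewrite /uniform_average swap_disjoint_pairs card_imset// big_imset//; exact: in2W.
Qed.

Lemma disjoint_pairs_gt0 a b : (a + b <= n)%N -> (0 < #|disjoint_pairs a b|)%N.
Proof.
move=> abn; have an : (a <= n)%N := leq_trans (leq_addr _ _) abn.
have : (0 < #|ksubsets [set: 'I_n] a|)%N.
  by rewrite card_ksubsets bin_gt0 cardsT card_ord.
move=> /card_gt0P[A]; rewrite inE => /andP[_ /eqP Aa].
have : (0 < #|ksubsets (~: A) b|)%N.
  by rewrite card_ksubsets bin_gt0 cardsCs setCK Aa card_ord leq_subRL.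
move=> /card_gt0P[B BA]; apply/card_gt0P; exists (A, B).
by rewrite inE BA inE finset.subsetT Aa eqxx.
Qed.

Lemma alternative_lawE a b p q G :
  alternative_law a b p q G =
  uniform_average (disjoint_pairs a b) (fun x => planted_law p q x.1 x.2 G).
Proof.
rewrite (uniform_average_disjoint_pairs _ _ (fun A B => planted_law p q A B G)).
rewrite /alternative_law; congr uniform_average.
by apply/setP => A; rewrite !inE finset.subsetT.
Qed.

Lemma crossingC A B : crossing B A =1 crossing A B.
Proof.
move=> e; apply/idP/idP => /existsP[i /andP[iA /existsP[j /andP[jB e_ij]]]];
  apply/existsP; exists j; rewrite jB/=; apply/existsP; exists i;
  by rewrite iA finset.setUC.
Qed.

Lemma planted_lawC p q A B : planted_law p q B A = planted_law p q A B.
Proof.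
by apply: funext => G; apply: eq_bigr => e _; rewrite crossingC.
Qed.

Lemma alternative_lawC a b p q G :
  alternative_law b a p q G = alternative_law a b p q G.
Proof.
rewrite !alternative_lawE uniform_average_swap.
by apply: eq_uniform_average => x _; rewrite planted_lawC.
Qed.

(** * Second moment of the likelihood ratio and the risk *)

Lemma sum_graph_prod (F : edge n -> bool -> R) :
  \sum_(G : graph n) \prod_(e : edge n) F e (G e) =
  \prod_(e : edge n) (F e true + F e false).
Proof.
rewrite -(bigA_distr_bigA F); apply: eq_bigr => e _.
by rewrite (bigD1 true)//= (bigD1 false)//= big1 ?addr0// => -[].
Qed.

Lemma sum_independent_edges (r : edge n -> R) :
  \sum_(G : graph n) independent_edges r G = 1.
Proof.
rewrite (sum_graph_prod (fun e c => if c then r e else 1 - r e)).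
by rewrite big1// => e _; rewrite addrC subrK.
Qed.

Lemma independent_edges_gt0 (r : edge n -> R) G :
  (forall e, 0 < r e < 1) -> 0 < independent_edges r G.
Proof.
move=> r01; apply: prodr_gt0 => e _; have /andP[r0 r1] := r01 e.
by case: (G e); rewrite // subr_gt0.
Qed.

Lemma sum_alternative_law a b p q : (a + b <= n)%N ->
  \sum_(G : graph n) alternative_law a b p q G = 1.
Proof.
move=> abn; under eq_bigr do rewrite alternative_lawE.
rewrite -(uniform_average_sum predT (disjoint_pairs a b)
  (fun G x => planted_law p q x.1 x.2 G)).
under eq_uniform_average => x _ do rewrite sum_independent_edges.
by rewrite uniform_average_cst// disjoint_pairs_gt0.
Qed.

Definition common_crossing (x y : {set 'I_n} * {set 'I_n}) : {set edge n} :=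
  [set e | crossing x.1 x.2 e && crossing y.1 y.2 e].

(** The sum factorizes over edges. An edge crossing both pairs contributes [p ^ 2 / q + (1 - p) ^ 2
    / (1 - q) = 1 + chi2 p q]; for any other edge one of the two laws agrees with the null law, and
    the factor is 1. *)
Lemma sum_planted_likelihood p q (x y : {set 'I_n} * {set 'I_n}) :
  0 < q < 1 ->
  \sum_(G : graph n)
    planted_law p q x.1 x.2 G * planted_law p q y.1 y.2 G / null_law q G =
  (1 + chi2 p q) ^+ #|common_crossing x y|.
Proof.
move=> /andP[q0 q1].
pose r x (e : edge n) := if crossing x.1 x.2 e then p else q.
pose w (t : R) (c : bool) := if c then t else 1 - t.
rewrite (eq_bigr (fun G : graph n => \prod_(e : edge n)
  (w (r x e) (G e) * w (r y e) (G e) / w q (G e)))); last first.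
  move=> G _; rewrite /planted_law /null_law /independent_edges.
  by rewrite -big_split/= -prodfV -big_split.
rewrite (sum_graph_prod (fun e c => w (r x e) c * w (r y e) c / w q c)).
rewrite -prodr_const [RHS]big_mkcond/=; apply: eq_bigr => e _.
have q_neq0 : q != 0 by rewrite gt_eqF.
have q1_neq0 : 1 - q != 0 by rewrite gt_eqF// subr_gt0.
rewrite inE /w /r; case: (crossing x.1 _ e); case: (crossing y.1 _ e) => /=;
  rewrite /chi2; field; rewrite ?q_neq0 ?q1_neq0//.
Qed.

Lemma second_momentE a b p q : 0 < q < 1 ->
  \sum_(G : graph n) alternative_law a b p q G ^+ 2 / null_law q G =
  uniform_average (disjoint_pairs a b) (fun x =>
    uniform_average (disjoint_pairs a b) (fun y =>
      (1 + chi2 p q) ^+ #|common_crossing x y|)).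
Proof.
move=> q01; pose D := disjoint_pairs a b; pose P x G := planted_law p q x.1 x.2 G.
rewrite (eq_bigr (fun G => uniform_average D (fun x => uniform_average D
    (fun y => P x G * P y G / null_law q G)))).
  rewrite -(uniform_average_sum predT); apply: eq_uniform_average => x _.
  rewrite -(uniform_average_sum predT); apply: eq_uniform_average => y _.
  exact: sum_planted_likelihood.
move=> G _; rewrite alternative_lawE -/D.
set S := uniform_average D _; set N := null_law q G.
transitivity (uniform_average D (fun x => S / N * P x G)).
  by rewrite uniform_averageZl expr2 mulrAC.
apply: eq_uniform_average => x _; apply/esym.
under eq_uniform_average => y _ do rewrite mulrAC.
by rewrite uniform_averageZl mulrC mulrA mulrAC.
Qed.

(* For every value [t] in [0, 1] of the test, [P0 t + P1 (1 - t)] is at least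
   [min P0 P1 >= P1 - P1 ^ 2 / (4 P0)], by AM-GM. *)
Lemma risk_ge a b p q (phi : graph n -> R) : (a + b <= n)%N -> 0 < q < 1 ->
  is_test phi ->
  1 - (\sum_(G : graph n) alternative_law a b p q G ^+ 2 / null_law q G) / 4 <=
  risk a b p q phi.
Proof.
move=> abn q01 phi01; rewrite -{1}(sum_alternative_law p q abn).
rewrite mulr_suml -sumrB /risk -big_split/=; apply: ler_sum => G _.
have P0 : 0 < null_law q G by apply: independent_edges_gt0.
have /andP[t0 t1] := phi01 G.
move: (alternative_law _ _ _ _ _) (null_law q G) P0 (phi G) t0 t1 => x y y0 t t0 t1.
rewrite -subr_ge0.
(* Completing the square turns the coefficient [y - x + x ^ 2 / (4 y)] of [t] into
   [(x / 2 - y) ^ 2 / y]. *)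
have -> : y * t + x * (1 - t) - (x - x ^+ 2 / y / 4) =
   t * ((x / 2 - y) ^+ 2 / y) + (1 - t) * (x ^+ 2 / y / 4).
  by field; rewrite gt_eqF.
by apply: addr_ge0; apply: mulr_ge0; rewrite ?subr_ge0// ?divr_ge0// ?sqr_ge0//
  ?divr_ge0 ?sqr_ge0// ltW.
Qed.

(** This symmetry leaves only one term of each maximum in (i) and (ii) to be treated. *)
Lemma riskC a b p q (phi : graph n -> R) :
  risk b a p q phi = risk a b p q phi.
Proof.
by rewrite /risk; congr +%R; apply: eq_bigr => G _; rewrite alternative_lawC.
Qed.

(** Orient a common edge from [x.1] to [x.2]: with respect to [y] it has the same or the opposite
    orientation, one product for each. *)
Lemma card_common_crossing (x y : {set 'I_n} * {set 'I_n}) :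
  (#|common_crossing x y| <=
   #|x.1 :&: y.1| * #|x.2 :&: y.2| + #|x.1 :&: y.2| * #|x.2 :&: y.1|)%N.
Proof.
rewrite -(card_imset _ val_inj) -!cardsX.
pose D := setX (x.1 :&: y.1) (x.2 :&: y.2) :|: setX (x.1 :&: y.2) (x.2 :&: y.1).
apply: (@leq_trans #|D|); last by rewrite cardsU leq_subr.
apply: (@leq_trans #|[set [set u.1; u.2] | u in D]|); last exact: leq_imset_card.
apply/subset_leq_card/fintype.subsetP => _ /imsetP[e + ->].
rewrite inE => /andP[/existsP[i /andP[ix /existsP[j /andP[jx /eqP ex]]]]].
move=> /existsP[k /andP[ky /existsP[l /andP[ly /eqP ey]]]].
apply/imsetP; exists (i, j) => //; rewrite !inE ix jx/=.
(* Distinct endpoints rule out that [i] and [j] both match [k], or both match [l]. *)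
have ij : i != j by have := valP e; rewrite /= ex cards2; case: (i != j).
have := ey; rewrite ex => /setP ee.
have := ee i; have := ee j; rewrite !inE !eqxx orbT/=.
move=> /esym/orP[/eqP jk|/eqP jl] /esym/orP[/eqP ik|/eqP il].
- by rewrite ik jk eqxx in ij.
- by rewrite il jk ly ky orbT.
- by rewrite ik jl ly ky.
- by rewrite il jl eqxx in ij.
Qed.

End Model.

(** * Inequalities for gamma and the exponential *)

Section Gamma.
Variable R : realType.
Implicit Types (n a b s : nat).

Lemma gammaC n a b : gamma n a b = gamma n b a :> R.
Proof. by rewrite /gamma [a%:R * _]mulrC. Qed.

Lemma gamma_arg_ge0 n a b : 0 <= n%:R / (a%:R * b%:R) * (ln 2 / 2) :> R.
Proof. by rewrite !mulr_ge0 ?invr_ge0 ?mulr_ge0 ?ln_ge0// ler1n. Qed.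

Lemma gamma_ge0 n a b : 0 <= gamma n a b :> R.
Proof. by rewrite ln_ge0// lerDl gamma_arg_ge0. Qed.

(* Concavity of [ln] gives [a / b * ln (1 + u) <= ln (1 + a / b * u)]. *)
Lemma gamma_mul_le n a b : (0 < a <= b)%N ->
  a%:R * gamma n a a <= b%:R * gamma n a b :> R.
Proof.
move=> /andP[a0 ab].
have a0' : 0 < a%:R :> R by rewrite ltr0n.
have b0' : 0 < b%:R :> R by rewrite ltr0n (leq_trans a0).
rewrite -ler_pdivrMl// mulrA [_^-1 * _]mulrC /gamma.
set u := n%:R / (a%:R * a%:R) * (ln 2 / 2).
have u0 : 0 <= u by exact: gamma_arg_ge0.
have s0 : 0 <= a%:R / b%:R :> R by rewrite divr_ge0// ltW.
have s1 : a%:R / b%:R <= 1 :> R by rewrite ler_pdivrMr// mul1r ler_nat.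
have u1 : 0 < 1 + u by rewrite ltr_pwDl.
have := concave_ln (Itv01 s0 s1) u1 ltr01.
rewrite !convRE/= ln1 mulr0 addr0.
suff -> : a%:R / b%:R * (1 + u) + unstable.onem (a%:R / b%:R) * 1 =
    1 + n%:R / (a%:R * b%:R) * (ln 2 / 2) by [].
by rewrite /unstable.onem /u; field; rewrite !gt_eqF.
Qed.

Lemma gamma_le n a b : (0 < b <= a)%N -> gamma n a a <= gamma n a b :> R.
Proof.
move=> /andP[b0 ba]; have a0 := leq_trans b0 ba.
rewrite ler_ln ?posrE ?ltr_pwDl ?gamma_arg_ge0// lerD2l.
rewrite ler_wpM2r ?divr_ge0 ?ln_ge0 ?ler1n// ler_wpM2l//.
by rewrite lef_pV2 ?posrE -?natrM ?ltr0n ?muln_gt0 ?a0// ler_nat leq_mul2l ba orbT.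
Qed.

(** Transfers condition (i), stated with [gamma n a a], to intersections of sets of different sizes,
    where [gamma n a b] is the threshold. *)
Lemma minn_gamma_le n a b : (0 < a)%N -> (0 < b)%N ->
  (minn a b)%:R * gamma n a a <= b%:R * gamma n a b :> R.
Proof.
move=> a0 b0; case: leqP => [ab|/ltnW ba]; first by rewrite gamma_mul_le ?a0.
by rewrite ler_wpM2l// gamma_le ?b0.
Qed.

(** Square [expR (x / 2) <= (1 - x / 2)^-1]; the remaining polynomial inequality factors with
    nonnegative factors on [0, 1]. *)
Lemma expR_le1D3x (x : R) : 0 <= x <= 1 -> expR x <= 1 + 3 * x.
Proof.
move=> /andP[x0 x1].
have h0 : 0 < 1 - x / 2 by lra.
have : expR (x / 2) <= (1 - x / 2)^-1.
  by rewrite -[expR _]invrK lef_pV2 ?posrE ?invr_gt0 ?expR_gt0// -expRN expR_ge1Dx.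
rewrite -(@ler_pXn2r _ 2) ?nnegrE ?expR_ge0 ?invr_ge0 ?(ltW h0)//.
rewrite -expRM_natr divfK// => /le_trans; apply.
rewrite exprVn -div1r ler_pdivrMr ?exprn_gt0//.
rewrite -subr_ge0 (_ : _ - 1 = x * (1 - x) * (2 - 3 / 4 * x)); last by field.
by rewrite !mulr_ge0//; lra.
Qed.

Lemma expR_midpoint_le (x y : R) :
  expR (2^-1 * (x + y)) <= 2^-1 * (expR x + expR y).
Proof.
have sq z : expR z = expR (2^-1 * z) ^+ 2 :> R.
  by rewrite -expRM_natl mulrA divff// mul1r.
rewrite mulrDr expRD (sq x) (sq y).
have := sqr_ge0 (expR (2^-1 * x) - expR (2^-1 * y)); nra.
Qed.

End Gamma.

(** * Exponential moments of products of intersections *)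

Section SecondMoment.
Context {R : realType} {n : nat}.
Implicit Types (S T : {set 'I_n}) (a b : nat) (mu : R).

(* Only the first set is averaged: the second intersection is bounded by
   [minn #|T| b]. *)
Lemma disjoint_pairs_mgf_outer a b S T mu :
  (0 < a)%N -> (a + b <= n)%N -> (0 < #|S|)%N -> 0 <= mu ->
  mu * (minn #|T| b)%:R <= gamma n #|S| a ->
  uniform_average (disjoint_pairs a b)
    (fun y => expR (mu * (#|S :&: y.1| * #|T :&: y.2|)%:R)) <= 3 / 2.
Proof.
move=> a0 abn S0 mu0 small.
have an := leq_trans (leq_addr _ _) abn.
rewrite (uniform_average_disjoint_pairs _ _
  (fun A B => expR (mu * (#|S :&: A| * #|T :&: B|)%:R))).
apply: le_trans (hypergeometric_mgf_gamma _ S0 (k := a) _); last by rewrite a0.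
apply: ler_uniform_average => A; rewrite inE => /andP[_ /eqP Aa].
apply: uniform_average_le => [|B].
  by rewrite card_ksubsets bin_gt0 cardsCs setCK Aa card_ord leq_subRL.
rewrite inE => /andP[_ /eqP Bb]; rewrite ler_expR natrM mulrCA mulrC.
apply: ler_wpM2r => //; apply: le_trans small; apply: ler_wpM2l => //.
rewrite ler_nat leq_min subset_leq_card ?subsetIl//=.
by rewrite -Bb subset_leq_card// subsetIr.
Qed.

(* Given the first set A, the second one is uniform in [~: A]; averaging over it
   first leaves [exp (gamma * #|S :&: A|)]. *)
Lemma disjoint_pairs_mgf_inner a b S T mu :
  (0 < a)%N -> (0 < b)%N -> (4 * (a + b) <= n)%N -> (0 < #|S|)%N -> 0 <= mu ->
  mu * a%:R <= 1 -> 4 * mu * (b%:R * #|T|%:R) <= n%:R * gamma n #|S| a ->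
  uniform_average (disjoint_pairs a b)
    (fun y => expR (mu * (#|S :&: y.1| * #|T :&: y.2|)%:R)) <= 3 / 2.
Proof.
move=> a0 b0 abn S0 mu0 small_a small_b.
have an : (a <= n)%N by lia.
rewrite (uniform_average_disjoint_pairs _ _
  (fun A B => expR (mu * (#|S :&: A| * #|T :&: B|)%:R))).
apply: le_trans (hypergeometric_mgf_gamma _ S0 (k := a) _); last by rewrite a0.
apply: ler_uniform_average => A; rewrite inE => /andP[_ /eqP Aa].
set m : R := #|S :&: A|%:R.
have ma : m <= a%:R by rewrite ler_nat -Aa subset_leq_card// subsetIr.
have m0 : 0 <= m by [].
have cA : #|~: A| = (n - a)%N by rewrite cardsCs setCK Aa card_ord.
rewrite (eq_uniform_average (g := fun B => expR (mu * m) ^+ #|T :&: B|));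
  last by move=> B _; rewrite natrM mulrA expRM_natr.
apply: le_trans (hypergeometric_mgf_le _ _ _ _) _.
- by rewrite cA; lia.
- by rewrite cA; lia.
- by rewrite -expR0 ler_expR mulr_ge0.
rewrite ler_expR cA.
(* Keeps the exponent in the range of [expR_le1D3x]. *)
have x01 : 0 <= mu * m <= 1.
  by rewrite mulr_ge0//= (le_trans _ small_a)// ler_wpM2l.
have na : 0 < (n - a)%:R :> R by rewrite ltr0n; lia.
rewrite mulrA mulrA mulrAC ler_pdivrMr//.
(* Since [a <= n / 4], passing from [n] to [n - a] costs a factor 4/3, which turns the 3 of
   [expR_le1D3x] into the 4 of [small_b]. *)
have na4 : 3 * n%:R <= 4 * (n - a)%:R :> R by rewrite -!natrM ler_nat; lia.
have g0 := gamma_ge0 R n #|S| a.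
have := expR_le1D3x x01; set E := expR _ => hE.
apply: (@le_trans _ _ (b%:R * #|T|%:R * (3 * (mu * m)))).
  by rewrite [#|T|%:R * _]mulrC ler_wpM2l ?mulr_ge0//; lra.
apply: (@le_trans _ _ (3 / 4 * (n%:R * gamma n #|S| a) * m)).
  have -> : b%:R * #|T|%:R * (3 * (mu * m)) =
     3 / 4 * (4 * mu * (b%:R * #|T|%:R)) * m by field.
  by rewrite ler_wpM2r// ler_wpM2l.
have -> : gamma n #|S| a * m * (n - a)%:R =
   (4 * (n - a)%:R) / 4 * gamma n #|S| a * m :> R by field.
rewrite ler_wpM2r// mulrA ler_wpM2r//; lra.
Qed.

End SecondMoment.

(** * Lower bound on the risk for fixed n *)

Section RiskLowerBound.
Context {R : realType} {n : nat}.
Implicit Types (a b : nat) (p q : R).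

(* Conditions (i) and (ii), each for one of the two terms of its maximum; the
   other terms are obtained by exchanging a and b. *)
Definition favourable a b p q : Prop :=
  chi2 p q <= gamma n a a / (2 * b%:R) \/
  chi2 p q <= Num.min (1 / (2 * a%:R)) (n%:R * gamma n a a / (8 * b%:R ^+ 2)).

Lemma chi2_ge0 p q : 0 < q < 1 -> 0 <= chi2 p q.
Proof.
by move=> /andP[q0 q1]; rewrite divr_ge0 ?sqr_ge0// mulr_ge0 ?subr_ge0// ltW.
Qed.

(** For [#|S| = a], [favourable] is exactly what is needed. For the exchanged sizes the threshold is
    [gamma n b a]: case (i) passes through [minn_gamma_le], case (ii) uses the general bound on
    chi2. *)
Lemma disjoint_pairs_mgf a b p q (S T : {set 'I_n}) :
  (0 < a)%N -> (0 < b)%N -> (4 * (a + b) <= n)%N -> 0 < q < 1 ->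
  chi2 p q <= n%:R * gamma n a b / (8 * a%:R * b%:R) ->
  favourable a b p q ->
  (#|S| = a /\ #|T| = b) \/ (#|S| = b /\ #|T| = a) ->
  uniform_average (disjoint_pairs a b) (fun y =>
    expR (2 * chi2 p q * (#|S :&: y.1| * #|T :&: y.2|)%:R)) <= 3 / 2.
Proof.
move=> a0 b0 abn q01 bound fav ST.
move: (chi2_ge0 p q01) bound fav; rewrite /favourable.
move: (chi2 p q) => lam lam0 bound fav.
have a0' : 0 < a%:R :> R by rewrite ltr0n.
have b0' : 0 < b%:R :> R by rewrite ltr0n.
have S0 : (0 < #|S|)%N by case: ST => -[->].
have abn' : (a + b <= n)%N by lia.
have mu0 : 0 <= 2 * lam by rewrite mulr_ge0.
case: fav => [small|].
  have {}small : 2 * lam * b%:R <= gamma n a a.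
    by move: small; rewrite ler_pdivlMr ?mulr_gt0// mulrCA mulrA.
  apply: disjoint_pairs_mgf_outer => //; case: ST => -[-> ->].
    by rewrite minnn.
  have m0 : 0 <= (minn a b)%:R :> R by [].
  rewrite gammaC -(ler_pM2l b0'); apply: le_trans (minn_gamma_le _ _ a0 b0).
  by rewrite mulrA [b%:R * _]mulrC [leRHS]mulrC ler_wpM2r.
rewrite le_min => /andP[small_a small_b].
have {}small_a : 2 * lam * a%:R <= 1.
  by move: small_a; rewrite ler_pdivlMr ?mulr_gt0// mulrCA mulrA.
apply: disjoint_pairs_mgf_inner => //; case: ST => -[-> ->].
  move: small_b; rewrite ler_pdivlMr ?mulr_gt0 ?exprn_gt0// => /(le_trans _); apply.
  by rewrite le_eqVlt; apply/orP; left; apply/eqP; ring.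
move: bound; rewrite ler_pdivlMr ?mulr_gt0// gammaC => /(le_trans _); apply.
by rewrite le_eqVlt; apply/orP; left; apply/eqP; ring.
Qed.

Lemma second_moment_le a b p q :
  (0 < a)%N -> (0 < b)%N -> (4 * (a + b) <= n)%N -> 0 < q < 1 ->
  chi2 p q <= n%:R * gamma n a b / (8 * a%:R * b%:R) ->
  favourable a b p q ->
  \sum_(G : graph n) alternative_law a b p q G ^+ 2 / null_law q G <= 3 / 2.
Proof.
move=> a0 b0 abn q01 bound fav; rewrite second_momentE//.
have lam0 := chi2_ge0 p q01.
(* The first copy [(A, B)] is fixed; the bound on the average over the second is uniform in it. *)
apply: uniform_average_le => [|[A B]]; first by apply: disjoint_pairs_gt0; lia.
rewrite !inE/= => /andP[/andP[_ /eqP Aa] /andP[_ /eqP Bb]].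
(* The factor 2 compensates for the halved exponents in [expR_midpoint_le]. *)
pose e S T (y : {set 'I_n} * {set 'I_n}) : R :=
  expR (2 * chi2 p q * (#|S :&: y.1| * #|T :&: y.2|)%:R).
have mgf (S T : {set 'I_n}) : (#|S| = a /\ #|T| = b) \/ (#|S| = b /\ #|T| = a) ->
    uniform_average (disjoint_pairs a b) (e S T) <= 3 / 2.
  exact: disjoint_pairs_mgf.
have eAB := mgf A B (or_introl (conj Aa Bb)).
have eBA := mgf B A (or_intror (conj Bb Aa)).
apply: (@le_trans _ _ (uniform_average (disjoint_pairs a b)
    (fun y => 2^-1 * (e A B y + e B A y)))).
  apply: ler_uniform_average => y _; apply: le_trans (expR_midpoint_le _ _).
  apply: (@le_trans _ _ (expR (chi2 p q) ^+ #|common_crossing (A, B) y|)).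
    by rewrite lerXn2r ?nnegrE ?expR_ge0 ?addr_ge0// expR_ge1Dx.
  rewrite -expRM_natr ler_expR.
  have -> (u v : R) : 2^-1 * (2 * chi2 p q * u + 2 * chi2 p q * v) =
      chi2 p q * (u + v) by field.
  rewrite -natrD ler_wpM2l// ler_nat.
  by apply: leq_trans (card_common_crossing _ _) _; rewrite [(#|_ :&: y.2| * _)%N]mulnC.
rewrite uniform_averageZl uniform_averageD; lra.
Qed.

Lemma le_risk_favourable a b p q (phi : graph n -> R) :
  (0 < a)%N -> (0 < b)%N -> (4 * (a + b) <= n)%N -> 0 < q < 1 ->
  chi2 p q <= n%:R * gamma n a b / (8 * a%:R * b%:R) ->
  favourable a b p q -> is_test phi -> 5 / 8 <= risk a b p q phi.
Proof.
move=> a0 b0 abn q01 bound fav phi01.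
apply: le_trans (risk_ge p _ q01 phi01); last by lia.
(* Numerically, [1 - (3 / 2) / 4 = 5 / 8]. *)
have := second_moment_le a0 b0 abn q01 bound fav; lra.
Qed.

Lemma le_risk a b p q (phi : graph n -> R) :
  (0 < a)%N -> (0 < b)%N -> (4 * (a + b) <= n)%N -> 0 < q < 1 ->
  chi2 p q <= n%:R * gamma n a b / (8 * a%:R * b%:R) ->
  favourable a b p q \/ favourable b a p q ->
  is_test phi -> 5 / 8 <= risk a b p q phi.
Proof.
move=> a0 b0 abn q01 bound [] fav phi01; first exact: le_risk_favourable.
rewrite -riskC; apply: le_risk_favourable => //; first by rewrite addnC.
by rewrite gammaC (mulrAC 8).
Qed.

End RiskLowerBound.

(** * Passage to the asymptotic regime *)

Unset Implicit Arguments.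
Set Strict Implicit.
Set Printing Implicit Defensive.

Local Open Scope classical_set_scope.

Theorem theorem1 (R : realType) (kR kL : nat -> nat) (p q : nat -> R)
  (kR_gt0 : forall n, (0 < kR n)%N) (kL_gt0 : forall n, (0 < kL n)%N)
  (q_gt0 : forall n, 0 < q n) (q_lt1 : forall n, q n < 1)
  (q_lt_p : forall n, q n < p n) (p_le1 : forall n, p n <= 1)
  (sparse : (fun n => (kR n + kL n)%:R : R^o) =o_\oo (fun n => n%:R : R^o))
  (bound : \forall n \near \oo,
     chi2 (p n) (q n) <=
       n%:R * gamma n (kR n) (kL n) / (8 * (kR n)%:R * (kL n)%:R))
  (cond : \forall n \near \oo,
     (* (i) *)
     chi2 (p n) (q n) <=
       Num.max (gamma n (kR n) (kR n) / (2 * (kL n)%:R))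
               (gamma n (kL n) (kL n) / (2 * (kR n)%:R))
     \/
     (* (ii) *)
     chi2 (p n) (q n) <=
       Num.max
         (Num.min (1 / (2 * (kL n)%:R))
                  (n%:R * gamma n (kL n) (kL n) / (8 * (kR n)%:R ^+ 2)))
         (Num.min (1 / (2 * (kR n)%:R))
                  (n%:R * gamma n (kR n) (kR n) / (8 * (kL n)%:R ^+ 2)))) :
  ~ strong_detection kR kL p q /\
  \forall n \near \oo, 1 / 2 < optimal_risk n (kR n) (kL n) (p n) (q n).
Proof.
(* A bound uniform over tests and strictly above 1/2 survives the infimum and also excludes
   convergence to 0. *)
have le58 : \forall n \near \oo, forall phi : graph n -> R, is_test phi ->
    5 / 8 <= risk (kR n) (kL n) (p n) (q n) phi.
  (* The constant 1/4 in the little-o yields [4 * (kR n + kL n) <= n]. *)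
  have quarter0 : 0 < 1 / 4 :> R by rewrite divr_gt0.
  move/eqoP : sparse => /(_ _ quarter0) sparse4.
  apply: filterS3 sparse4 bound cond => n sparse_n bound_n cond_n phi phi01.
  apply: le_risk => //; last 1 first.
  - by case: cond_n; rewrite le_max => /orP[] c; rewrite /favourable; auto.
  - by move: sparse_n; rewrite !normr_nat mulrC mul1r ler_pdivlMr// mulrC
      -natrM ler_nat.
  - by rewrite q_gt0 q_lt1.
split; last first.
  apply: filterS le58 => n le58; apply: (@lt_le_trans _ _ (5 / 8)); first lra.
  apply: lb_le_inf => [|_ [phi phi01 <-]]; last exact: le58.
  (* The test that always answers 0 shows that the set of risks is nonempty, as the infimum bound
     requires. *)
  eexists; exists (fun=> 0 : R) => [G|]; last by [].
  by rewrite lexx ler01.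
move=> [phi [phi01 /cvgrPdist_lt /(_ (5 / 8))]].
have h : 0 < 5 / 8 :> R by lra.
move=> /(_ h) small.
have [n [+ /(_ _ (phi01 n))]] := filter_ex (filterI small le58).
rewrite sub0r normrN => /(le_lt_trans (ler_norm _)) lt58 ge58.
by have := le_lt_trans ge58 lt58; rewrite ltxx.
Qed.
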